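(* Let $k$ be a positive integer and let $L_k$ denote the linear equation \[ \sum_{i=1}^{k-1} \frac{2^i}{2^i-1} x_i = \left( -1 + \sum_{i=1}^{k-1} \frac{2^i}{2^i-1} \right) x_0 \] in the variables $x_0, x_1, \dots, x_{k-1}$. Then $L_k$ is $(k-1)$-regular but not $k$-regular. That is, every coloring of the positive integers with $k-1$ colors admits a monochromatic solution to $L_k$, while there exists a coloring of the positive integers with $k$ colors admitting no monochromatic solution to $L_k$.
   Context: A linear equation $L$ is called $k$-regular if every $k$-coloring of the positive integers (i.e., every map from the positive integers to a set of $k$ colors) contains a monochromatic solution to $L$, meaning an assignment of positive integers to all the variables of $L$ satisfying $L$ such that all assigned values receive the same color. The values of the variables in a solution are not required to be distinct. *)

(* Defs.v *)
From HB Require Import structures.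
From mathcomp Require Import all_boot all_order all_algebra.

Set Implicit Arguments.
Unset Strict Implicit.
Unset Printing Implicit Defensive.

Import Order.TTheory GRing.Theory Num.Theory.
Local Open Scope ring_scope.

Definition posint : Type := {m : nat | (0 < m)%N}.

(* An equation in [n] variables is represented by the predicate "the
   assignment [x] satisfies the equation". *)
Definition equation (n : nat) : Type := ('I_n -> posint) -> Prop.

Definition monochromatic (k n : nat) (c : posint -> 'I_k)
    (x : 'I_n -> posint) : Prop :=
  forall i j : 'I_n, c (x i) = c (x j).

Definition regular (k n : nat) (L : equation n) : Prop :=
  forall c : posint -> 'I_k,
    exists x : 'I_n -> posint, L x /\ monochromatic c x.

Definition Lcoef (i : nat) : rat := 2 ^+ i / (2 ^+ i - 1).

(* [hk] is only used to name the index of the variable x_0. *)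
Definition Leq (k : nat) (hk : (0 < k)%N) : equation k := fun x =>
  \sum_(i < k | (0 < i)%N) Lcoef i * (val (x i))%:R
  = (-1 + \sum_(i < k | (0 < i)%N) Lcoef i) * (val (x (Ordinal hk)))%:R.

(* Main.v *)
Require Import Defs.
From mathcomp Require Import all_boot all_order all_algebra.
From mathcomp Require Import ring.

(** Since [1 - 1 / c_d = 2^-d] for the coefficient [c_d = 2^d / (2^d - 1)], the
    assignment [x_d = y], [x_i = 2^d y] for [i <> d] solves the equation. Two of
    the [k] numbers [1, 2, ..., 2^(k-1)] share one of [k - 1] colors, so this
    yields a monochromatic solution. Conversely, color [n] by its 2-adic
    valuation modulo [k]: the coefficient of [x_i] has valuation [i], so in a
    monochromatic assignment the [k] terms of the equation have valuations
    distinct modulo [k], and their sum cannot vanish. *)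

Import Order.TTheory GRing.Theory Num.Theory.
Local Open Scope ring_scope.

(** Factoring out the least power [2 ^+ u m] leaves [b m] plus even terms, since [u] attains its
    minimum only at [m]; this cofactor is odd, hence non-zero. *)
Lemma sum_distinct_valuations_neq0 (k : nat) (u : 'I_k -> nat)
    (b : 'I_k -> int) :
  (0 < k)%N -> injective u -> (forall i, ~~ (2 %| b i)%Z) ->
  \sum_(i < k) 2 ^+ u i * b i != 0.
Proof.
move=> k_gt0 u_inj b_odd.
case: (@arg_minnP _ (Ordinal k_gt0) xpredT u isT) => m _ m_min.
have -> : \sum_(i < k) 2 ^+ u i * b i =
    2 ^+ u m * (b m + \sum_(i < k | i != m) 2 ^+ (u i - u m) * b i).
  rewrite (bigD1 m) //= mulrDr mulr_sumr; congr (_ + _).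
  by apply: eq_bigr => i _; rewrite mulrA -exprD subnKC // m_min.
rewrite mulf_neq0 ?expf_neq0 //; apply: contra (b_odd m).
rewrite addr_eq0 => /eqP ->; rewrite rpredN.
apply: rpred_sum => i i_neq_m; rewrite dvdz_mulr //.
have um_lt : (u m < u i)%N.
  by rewrite ltn_neqAle m_min // andbT (inj_eq u_inj) eq_sym.
by rewrite -(subnSK um_lt) exprS dvdz_mulr.
Qed.

Lemma odd_pow2_sub1 (i : nat) : (0 < i)%N -> ~~ (2 %| (2 ^+ i - 1 : int))%Z.
Proof. by case: i => // i _; rewrite exprS rpredDl ?dvdz_mulr. Qed.

Lemma two_dvdzM (a b : int) : (2 %| a * b)%Z = (2 %| a)%Z || (2 %| b)%Z.
Proof. by rewrite !dvdzE abszM Euclid_dvdM. Qed.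

Lemma odd_prod (I : Type) (r : seq I) (P : pred I) (F : I -> int) :
  (forall i, P i -> ~~ (2 %| F i)%Z) -> ~~ (2 %| \prod_(i <- r | P i) F i)%Z.
Proof.
move=> F_odd; elim/big_rec: _ => // i p Pi p_odd.
by rewrite two_dvdzM negb_or F_odd.
Qed.

Lemma pow2_sub1_neq0 (i : nat) : (0 < i)%N -> (2 ^+ i - 1 : rat) != 0.
Proof. by move=> i_gt0; rewrite subr_eq0 gt_eqF // exprn_egt1 // -lt0n. Qed.

Lemma dilated_solution (k : nat) (hk : (0 < k)%N) (d : 'I_k)
    (x : 'I_k -> posint) (y : nat) :
  (0 < d)%N -> val (x d) = y ->
  (forall i, i != d -> val (x i) = (2 ^ d * y)%N) -> Leq hk x.
Proof.
(* As [d > 0], the variable x_0 also has the value [2 ^ d * y]. The terms with [i != d] then cancel,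
   leaving [Lcoef d * y = (Lcoef d - 1) * 2 ^ d * y]. *)
move=> d_gt0 xd xi; rewrite /Leq xi; last first.
  by rewrite -val_eqE /= eq_sym -lt0n.
rewrite (bigD1 d) //= [in RHS](bigD1 d) //= xd.
under eq_bigr => i /andP[_ /xi ->] do [].
rewrite -mulr_suml /Lcoef natrM natrX.
by field; rewrite pow2_sub1_neq0.
Qed.

Lemma Leq_regular (k : nat) (hk : (0 < k)%N) : regular k.-1 (Leq hk).
Proof.
move=> c.
have pow_gt0 i : (0 < 2 ^ i)%N by rewrite expn_gt0.
pose p i : posint := exist _ (2 ^ i)%N (pow_gt0 i).
have /injectivePn[i [j i_neq_j cij]] : ~~ injectiveb (fun i : 'I_k => c (p i)).
  apply/injectiveP => /leq_card; rewrite !card_ord.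
  by rewrite leqNgt prednK // leqnn.
wlog lt_ij : i j i_neq_j cij / (i < j)%N.
  move=> hw; have [|lt_ji|/val_inj eq_ij] := ltngtP i j; first exact: hw.
    by apply: (hw j i) => //; rewrite eq_sym.
  by rewrite eq_ij eqxx in i_neq_j.
(* Dilate with [d = j - i] and [y = 2 ^ i], so that [2 ^ d * y = 2 ^ j]. *)
have d_lt : (j - i < k)%N by rewrite (leq_ltn_trans (leq_subr _ _)).
exists (fun l => if l == Ordinal d_lt then p i else p j); split.
  apply: (@dilated_solution _ _ (Ordinal d_lt) _ (2 ^ i)%N).
  - by rewrite /= subn_gt0.
  - by rewrite eqxx.
  - by move=> l /negPf ->; rewrite -expnD /= subnK // ltnW.
by move=> l l'; do 2![case: ifP => _].
Qed.

Definition denom (k : nat) : int := \prod_(i < k | (0 < i)%N) (2 ^+ i - 1).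

(** For [i > 0] this is the quotient of [denom k] by [2 ^+ i - 1], kept as a product to stay in
    [int]. *)
Definition codenom {k : nat} (i : 'I_k) : int :=
  \prod_(j < k | (0 < j)%N && (j != i)) (2 ^+ j - 1).

(* After multiplication by [denom k], with all terms moved to the left-hand
   side, the coefficient of [x_i] is [2 ^ i * odd_coef i]. *)
Definition odd_coef {k : nat} (i : 'I_k) : int :=
  if (0 < i)%N then codenom i
  else denom k - \sum_(j < k | (0 < j)%N) 2 ^+ j * codenom j.

Lemma odd_codenom (k : nat) (i : 'I_k) : ~~ (2 %| codenom i)%Z.
Proof. by apply: odd_prod => j /andP[j_gt0 _]; apply: odd_pow2_sub1. Qed.

(** At [i = 0], the odd number [denom k] is altered only by multiples of [2 ^+ j] with [j > 0]. *)
Lemma odd_odd_coef (k : nat) (i : 'I_k) : ~~ (2 %| odd_coef i)%Z.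
Proof.
rewrite /odd_coef; case: ifP => _; first exact: odd_codenom.
rewrite rpredDr; first by apply: odd_prod => j; apply: odd_pow2_sub1.
rewrite rpredN; apply: rpred_sum => -[[|j] j_lt] /= j_gt0; first by [].
by rewrite exprS -mulrA dvdz_mulr.
Qed.

Lemma denom_Lcoef (k : nat) (i : 'I_k) : (0 < i)%N ->
  (denom k)%:~R * Lcoef i = (2 ^+ i * codenom i)%:~R.
Proof.
move=> i_gt0; rewrite /denom (bigD1 i) //= -/(codenom i) /Lcoef.
rewrite !rmorphM rmorphB /= rmorphXn /=.
by field; rewrite pow2_sub1_neq0.
Qed.

Lemma Leq_integral (k : nat) (hk : (0 < k)%N) (x : 'I_k -> posint) : Leq hk x ->
  \sum_(i < k) 2 ^+ i * odd_coef i * (val (x i))%:Z = 0.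
Proof.
move=> /(congr1 ( *%R (denom k)%:~R)); rewrite mulrA mulrDr mulrN1 !mulr_sumr.
under eq_bigr => i i_gt0 do rewrite mulrA denom_Lcoef //.
under [in RHS]eq_bigr => i i_gt0 do rewrite denom_Lcoef //.
(* The denominators were cleared in [rat], so the integer identity is checked there. *)
move=> eqx; apply: (@intr_inj rat).
rewrite (bigD1 (Ordinal hk)) //= {1}/odd_coef /= mul1r.
have neq0 (i : 'I_k) : (i != Ordinal hk) = (0 < i)%N by rewrite lt0n.
rewrite (eq_bigl _ _ neq0).
under [X in _ + X]eq_bigr => i i_gt0 do rewrite /odd_coef i_gt0.
rewrite rmorphD rmorphM rmorphB /= !rmorph_sum /=.
under [X in _ + X]eq_bigr => i _ do rewrite rmorphM /=.
by rewrite eqx -mulrDl [- _ + _]addrC -opprB addNr mul0r.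
Qed.

Lemma Leq_not_regular (k : nat) (hk : (0 < k)%N) : ~ regular k (Leq hk).
Proof.
move=> /(_ (fun y => Ordinal (ltn_pmod (logn 2 (val y)) hk))).
case=> x [/Leq_integral sum0 mono].
pose v i := logn 2 (val (x i)).
(* The 2-adic valuation of the [i]-th term, since [odd_coef i] is odd. *)
pose u (i : 'I_k) := (i + v i)%N.
have v_mod i j : v i = v j %[mod k] by have /(congr1 val) := mono i j.
have u_inj : injective u.
  (* All [v i] agree modulo [k], so [u i = u j] makes [i] and [j] congruent modulo [k], and both are
     below [k]. *)
  move=> i j /(congr1 (modn^~ k)); rewrite /u -modnDmr (v_mod i j) modnDmr.
  by move/eqP; rewrite eqn_modDr !modn_small // => /eqP /val_inj.
pose b (i : 'I_k) := odd_coef i * ((val (x i))`_2^')%N%:Z.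
have b_odd i : ~~ (2 %| b i)%Z.
  rewrite two_dvdzM negb_or odd_odd_coef dvdzE /=.
  by rewrite -(p'natE _ (isT : prime 2)) part_pnat.
have /negP[] := @sum_distinct_valuations_neq0 k u b hk u_inj b_odd.
rewrite -[X in _ == X]sum0; apply/eqP/eq_bigr => i _.
rewrite /u /b exprD -[in RHS](@partnC 2%N (val (x i))) ?(valP (x i)) // p_part.
rewrite PoszM -/(v i) -(natz (2 ^ v i)) natrX; ring.
Qed.

Theorem theorem1 (k : nat) (hk : (0 < k)%N) :
  regular k.-1 (Leq hk) /\ ~ regular k (Leq hk).
Proof. by split; [apply: Leq_regular | apply: Leq_not_regular]. Qed.
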